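(* Let $\mathcal{G}$ be a Lie algebra over $\mathbf{K}$ and let $n\ge 1$. On $\mathcal{G}^n$ consider the Lie bracket $$([\mathbf{x},\mathbf{y}]^{e_0})_i=\sum_{\substack{0\le s,k\le n-1\\ s+k\equiv i\ (\mathrm{mod}\ n)}}[x_s,y_k],\qquad 0\le i\le n-1.$$ With respect to this bracket, the decomposition $\mathcal{G}^n=\mathcal{F}_n^{(0)}\oplus\mathcal{F}_n^{(1)}\oplus\cdots\oplus\mathcal{F}_n^{(n-1)}$ is a $\mathbf{Z}_n$-grading. The $\lambda=0$ deformation $[\cdot,\cdot]_L$ of $[\cdot,\cdot]^{e_0}$ relative to this grading is a Lie bracket on $\mathcal{G}^n$, and it is given by the Leibnitz tensor, that is $$([\mathbf{x},\mathbf{y}]_L)_s=\sum_{i,j=0}^{n-1}W^{ij}_s[x_i,y_j],\qquad W^{ij}_s=\delta_s^{i+j},\quad 0\le i,j,s\le n-1.$$ It satisfies $[\mathcal{F}_n^{(i)},\mathcal{F}_n^{(j)}]_L\subset\mathcal{F}_n^{(i+j)}$ if $i+j\le n-1$, and $[\mathcal{F}_n^{(i)},\mathcal{F}_n^{(j)}]_L=0$ if $i+j>n-1$. Moreover, its solvable part is the solvable Leibnitz extension $\bar W^{ij}_k=\delta^{i+j}_k$, $1\le i,j,k\le n-1$.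
   Context: $\mathbf{K}$ is one of the classical fields ($\mathbb{R}$ or $\mathbb{C}$). Elements of $\mathcal{G}^n$ are $\mathbf{x}=(x_0,\ldots,x_{n-1})$ with $x_i\in\mathcal{G}$. $\mathcal{F}_n^{(i)}\subset\mathcal{G}^n$ is the subspace of those $\mathbf{x}$ with $x_j=0$ for all $j\ne i$. $\delta^m_s$ is the Kronecker symbol, and in $\delta_s^{i+j}$ the sum $i+j$ is the ordinary integer sum (not taken modulo $n$). A $\mathbf{Z}_n$-grading of a Lie algebra $\mathcal{H}$ is a decomposition $\mathcal{H}=\bigoplus_{i=0}^{n-1}\mathcal{H}^{(i)}$ with $[\mathcal{H}^{(i)},\mathcal{H}^{(j)}]\subset\mathcal{H}^{((i+j)\bmod n)}$. For $x=\sum_{i=0}^{n-1}x_i$ and $y=\sum_{i=0}^{n-1}y_i$ with $x_i,y_i\in\mathcal{H}^{(i)}$, the $\lambda$-deformation ($\lambda\in\mathbf{K}$) of the bracket relative to the grading has $\mathcal{H}^{(i)}$-component $$[x,y]_i^{\lambda}=\sum_{\substack{0\le s,l\le n-1\\ s+l=i}}[x_s,y_l]+\lambda\sum_{\substack{0\le s,l\le n-1\\ s+l=i+n}}[x_s,y_l],$$ where $s+l$ is the ordinary integer sum. So $\lambda=1$ gives the original bracket, and the $\lambda=0$ deformation keeps only the first sum. For a tensor $W^{ij}_k$ with indices $0\le i,j,k\le n-1$, its solvable part is the tensor $\bar W^{ij}_k=W^{ij}_k$ restricted to the indices $1\le i,j,k\le n-1$. *)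

(* Defs.v *)
From mathcomp Require Import all_boot all_order all_algebra.
From mathcomp Require Import boolp classical_sets reals complex.

Set Implicit Arguments.
Unset Strict Implicit.
Unset Printing Implicit Defensive.

Import GRing.Theory.
Local Open Scope ring_scope.

Variant classical := Real | Complex.

Definition classical_field (R : realType) (c : classical) : fieldType :=
  match c with
  | Real => R
  | Complex => R[i]
  end.

Record lie_bracket (K : fieldType) (V : lmodType K) (br : V -> V -> V) : Prop :=
  LieBracket {
    lie_linearl : forall y, linear (br^~ y);
    lie_linearr : forall x, linear (br x);
    lie_alternating : forall x, br x x = 0;
    lie_jacobi : forall x y z,
      br x (br y z) + br y (br z x) + br z (br x y) = 0
  }.

Section Gradings.
Variables (K : fieldType) (H : lmodType K) (n : nat).
Implicit Types (F : 'I_n -> set H) (br : H -> H -> H).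

Definition decomposes F (x : H) (z : {ffun 'I_n -> H}) : Prop :=
  (forall i, F i (z i)) /\ x = \sum_(i < n) z i.

Definition direct_decomposition F : Prop :=
  (forall i, submod_closed [in F i]) /\
  (forall x, exists! z, decomposes F x z).

Record cyclic_grading br F : Prop := CyclicGrading {
  grading_direct : direct_decomposition F;
  grading_bracket : forall i j k : 'I_n, ((i + j) %% n)%N = k ->
    forall x y, F i x -> F j y -> F k (br x y)
}.

(* The family of homogeneous components of x. The default value 0 is only
   reached when x has no decomposition along F. *)
Definition component F (x : H) : {ffun 'I_n -> H} :=
  xget 0 [set z | decomposes F x z].

(* The i-th summand is the component of degree i as soon as F is a grading. *)
Definition deformation br F (lambda : K) (x y : H) : H :=
  let xc := component F x in
  let yc := component F y in
  \sum_(i < n)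
    (\sum_(s < n) \sum_(l < n | (s + l == i)%N) br (xc s) (yc l)
     + lambda *:
       \sum_(s < n) \sum_(l < n | (s + l == i + n)%N) br (xc s) (yc l)).

End Gradings.

Section Powers.
Variables (K : fieldType) (G : lmodType K) (n : nat).

Definition cyclic_bracket (br : G -> G -> G)
    (x y : {ffun 'I_n -> G}) : {ffun 'I_n -> G} :=
  [ffun i : 'I_n =>
     \sum_(s < n) \sum_(k < n | s + k == i %[mod n]) br (x s) (y k)].

Definition coordinate_subspace (i : 'I_n) : set {ffun 'I_n -> G} :=
  [set x | forall j, j != i -> x j = 0].

End Powers.

Definition kronecker (K : fieldType) (m s : nat) : K := (m == s)%:R.

(* W i j k stands for the entry of W with upper indices i, j and lower
   index k. *)
Definition tensor (K : fieldType) (I : Type) := I -> I -> I -> K.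

Definition leibnitz_tensor (K : fieldType) (n : nat) : tensor K 'I_n :=
  fun i j s => kronecker K (i + j) s.

(* The indices 1, ..., n - 1. *)
Definition positive_index (n : nat) := {i : 'I_n | (0 < i)%N}.

Definition solvable_part (K : fieldType) (n : nat) (W : tensor K 'I_n) :
    tensor K (positive_index n) :=
  fun i j k => W (val i) (val j) (val k).

Definition solvable_leibnitz_tensor (K : fieldType) (n : nat) :
    tensor K (positive_index n) :=
  fun i j k => kronecker K (val (val i) + val (val j)) (val (val k)).

Arguments leibnitz_tensor : clear implicits.
Arguments solvable_leibnitz_tensor : clear implicits.

(* Main.v *)
From HB Require Import structures.
Require Import Defs.
From mathcomp Require Import all_boot all_order all_algebra.
From mathcomp Require Import boolp classical_sets reals complex.

Set Implicit Arguments.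
Unset Strict Implicit.
Unset Printing Implicit Defensive.

Import GRing.Theory.
Local Open Scope ring_scope.

(** Both brackets of the theorem combine [br] with structure constants [W],
    sending x and y to the tuple whose s-th coordinate is the sum over i, j of
    [W i j s *: br (x i) (y j)]. This amounts to tensoring the Lie algebra G
    with the n-dimensional algebra having a basis e_0, ..., e_(n-1) and product
    e_i e_j = \sum_s W i j s e_s, and the result is a Lie algebra as soon as
    that algebra is commutative and associative. This is
    [tensor_bracket_lie]. The [e_0] bracket comes from the group algebra of
    Z_n, that is K[t]/(t^n - 1), and the Leibnitz bracket from the truncated
    polynomials K[t]/(t^n). In both algebras the triple product of e_i, e_j, e_k
    only depends on i + j + k ([triple_cyclic_tensor],
    [triple_leibnitz_tensor]), which gives the two Lie brackets.

    The remaining claims rest on the identification of the deformation with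
    the Leibnitz bracket ([deformation0_cyclic_bracketE]). The homogeneous
    components of a tuple are its coordinates, put back in their own places
    ([coordinate_component]), and a bracket of homogeneous elements of degrees
    s and l reduces to one term ([tensor_bracket_homogeneous]). For lambda = 0
    the deformation keeps the terms of degree s + l < n, on which the group
    algebra and the truncated polynomials have the same structure
    constants. *)

Lemma linear_scaled_sum (K : fieldType) (U V : lmodType K) (f : U -> V) :
  linear f -> forall (I : finType) (c : I -> K) (v : I -> U),
  f (\sum_i c i *: v i) = \sum_i c i *: f (v i).
Proof.
move=> lin_f I c v.
pose g : {linear U -> V} := HB.pack f (GRing.isLinear.Build _ _ _ _ f lin_f).
by rewrite -[f]/(g : U -> V) linear_sum; apply: eq_bigr => i _; rewrite linearZ.
Qed.

Lemma linear0 (K : fieldType) (U V : lmodType K) (f : U -> V) :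
  linear f -> f 0 = 0.
Proof.
by move=> lin_f; have := lin_f (-1) 0 0; rewrite scaler0 addr0 scaleN1r addNr.
Qed.

(** The off-diagonal terms cancel in pairs. Peeling off one index at a time
    removes a row and a column that are opposite, so no division by 2 occurs
    and the argument holds in any characteristic. *)
Lemma sum_alternating (V : zmodType) (I : Type) (f : I -> I -> V) (r : seq I) :
  (forall i, f i i = 0) -> (forall i j, f i j = - f j i) ->
  \sum_(i <- r) \sum_(j <- r) f i j = 0.
Proof.
move=> fii fN; elim: r => [|a r IHr]; first by rewrite big_nil.
rewrite !big_cons fii add0r.
under [X in _ + X]eq_bigr => i _ do rewrite big_cons fN.
by rewrite big_split /= IHr addr0 sumrN subrr.
Qed.

Lemma lie_antisymmetric (K : fieldType) (V : lmodType K) (br : V -> V -> V) :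
  lie_bracket br -> forall x y, br x y = - br y x.
Proof.
move=> hbr x y; apply/eqP; rewrite -addr_eq0; apply/eqP.
have Dl x1 x2 z : br (x1 + x2) z = br x1 z + br x2 z.
  by have := lie_linearl hbr z 1 x1 x2; rewrite /= !scale1r.
have Dr x1 x2 z : br z (x1 + x2) = br z x1 + br z x2.
  by have := lie_linearr hbr z 1 x1 x2; rewrite /= !scale1r.
have := lie_alternating hbr (x + y).
by rewrite Dl !Dr !(lie_alternating hbr) add0r addr0.
Qed.

Definition tensor_bracket (K : fieldType) (G : lmodType K) (n : nat)
    (W : tensor K 'I_n) (br : G -> G -> G) (x y : {ffun 'I_n -> G}) :
    {ffun 'I_n -> G} :=
  [ffun s => \sum_(i < n) \sum_(j < n) W i j s *: br (x i) (y j)].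

(** The coefficient of e_m in the product e_i (e_j e_k) of the algebra with
    structure constants W. *)
Definition triple_tensor (K : fieldType) (n : nat) (W : tensor K 'I_n)
    (i j k m : 'I_n) : K :=
  \sum_(s < n) W i s m * W j k s.

Lemma tensor_bracket_nested (K : fieldType) (G : lmodType K) (n : nat)
    (W : tensor K 'I_n) (br : G -> G -> G) (hbr : lie_bracket br)
    (x y z : {ffun 'I_n -> G}) (m : 'I_n) :
  tensor_bracket W br x (tensor_bracket W br y z) m =
  \sum_(i < n) \sum_(j < n) \sum_(k < n)
    triple_tensor W i j k m *: br (x i) (br (y j) (z k)).
Proof.
rewrite ffunE; apply: eq_bigr => i _.
transitivity (\sum_(s < n) \sum_(j < n) \sum_(k < n)
    (W i s m * W j k s) *: br (x i) (br (y j) (z k))).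
  apply: eq_bigr => s _; rewrite ffunE pair_big /=.
  rewrite (linear_scaled_sum (lie_linearr hbr (x i))
             (fun p => W p.1 p.2 s) (fun p => br (y p.1) (z p.2))).
  rewrite scaler_sumr pair_big /=.
  by apply: eq_bigr => p _; rewrite scalerA.
rewrite exchange_big; apply: eq_bigr => j _.
by rewrite exchange_big; apply: eq_bigr => k _; rewrite -scaler_suml.
Qed.

(** The second hypothesis says that e_i (e_j e_k) is invariant under cyclic
    permutation of i, j, k; together with commutativity this is associativity.
    After renaming the indices of the second and third terms of the Jacobi
    identity, the three terms with given i, j, k therefore carry the same
    coefficient, and they cancel by the Jacobi identity of G. *)
Lemma tensor_bracket_lie (K : fieldType) (G : lmodType K) (n : nat)
    (W : tensor K 'I_n) (br : G -> G -> G) (hbr : lie_bracket br) :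
  (forall i j s, W i j s = W j i s) ->
  (forall i j k m, triple_tensor W i j k m = triple_tensor W j k i m) ->
  lie_bracket (tensor_bracket W br).
Proof.
move=> Wsym Wrot; split.
- move=> y a u v; apply/ffunP=> s; rewrite !ffunE scaler_sumr -big_split /=.
  apply: eq_bigr => i _; rewrite scaler_sumr -big_split /=.
  apply: eq_bigr => j _; rewrite !ffunE (lie_linearl hbr) scalerDr.
  by rewrite !scalerA mulrC.
- move=> x a u v; apply/ffunP=> s; rewrite !ffunE scaler_sumr -big_split /=.
  apply: eq_bigr => i _; rewrite scaler_sumr -big_split /=.
  apply: eq_bigr => j _; rewrite !ffunE (lie_linearr hbr) scalerDr.
  by rewrite !scalerA mulrC.
- move=> x; apply/ffunP=> s; rewrite !ffunE.
  apply: (@sum_alternating _ _ (fun i j => W i j s *: br (x i) (x j))) => [i|i j].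
    by rewrite (lie_alternating hbr) scaler0.
  by rewrite Wsym (lie_antisymmetric hbr) scalerN.
- move=> x y z; apply/ffunP=> m.
  rewrite 2!ffunE [RHS]ffunE !tensor_bracket_nested //.
  (* Each of the last two terms is summed anew so that i, j, k are always the
     indices of x, y, z. *)
  rewrite [X in _ + X + _](_ : _ = \sum_(i < n) \sum_(j < n) \sum_(k < n)
    triple_tensor W i j k m *: br (y j) (br (z k) (x i))); last first.
    rewrite [RHS]exchange_big; apply: eq_bigr => j _.
    rewrite [RHS]exchange_big; apply: eq_bigr => k _.
    by apply: eq_bigr => i _; rewrite (Wrot i).
  rewrite [X in _ + _ + X](_ : _ = \sum_(i < n) \sum_(j < n) \sum_(k < n)
    triple_tensor W i j k m *: br (z k) (br (x i) (y j))); last first.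
    rewrite exchange_big; apply: eq_bigr => i _.
    rewrite exchange_big; apply: eq_bigr => j _.
    by apply: eq_bigr => k _; rewrite (Wrot k).
  rewrite -!big_split big1 //= => i _; rewrite -!big_split big1 //= => j _.
  rewrite -!big_split big1 //= => k _.
  by rewrite -!scalerDr (lie_jacobi hbr) scaler0.
Qed.

(** The index p may fall outside the range 0, ..., n - 1 of summation; this is
    where the truncation t^n = 0 enters. *)
Lemma sum_mul_kronecker (K : fieldType) (n p : nat) (f : nat -> K) :
  \sum_(s < n) f s * kronecker K p s = if (p < n)%N then f p else 0.
Proof.
case: ltnP => [p_lt|n_le]; last first.
  apply: big1 => s _; rewrite /kronecker.
  by rewrite gtn_eqF ?mulr0 // (leq_trans (ltn_ord s)).
rewrite (bigD1 (Ordinal p_lt)) //= /kronecker eqxx mulr1 big1 ?addr0 // => s.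
by rewrite -val_eqE eq_sym /= => /negPf ->; rewrite mulr0.
Qed.

(** The structure constants of the group algebra of Z_n. *)
Definition cyclic_tensor (K : fieldType) (n : nat) : tensor K 'I_n :=
  fun i j s => kronecker K ((i + j) %% n) s.

Lemma triple_leibnitz_tensor (K : fieldType) (n : nat) (i j k m : 'I_n) :
  triple_tensor (leibnitz_tensor K n) i j k m = kronecker K (i + j + k) m.
Proof.
rewrite [LHS](@sum_mul_kronecker K n (j + k) (fun s => kronecker K (i + s) m)).
rewrite addnA; case: ltnP => // n_le.
(* When j + k >= n, the inner product is 0, and i + j + k exceeds m < n. *)
rewrite /kronecker gtn_eqF //.
by rewrite -addnA ltn_addl // (leq_trans (ltn_ord m)).
Qed.

Lemma triple_cyclic_tensor (K : fieldType) (n : nat) (i j k m : 'I_n) :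
  triple_tensor (@cyclic_tensor K n) i j k m = kronecker K ((i + j + k) %% n) m.
Proof.
rewrite [LHS](@sum_mul_kronecker K n ((j + k) %% n)
          (fun s => kronecker K ((i + s) %% n) m)).
by rewrite ltn_pmod ?(leq_ltn_trans _ (ltn_ord m)) // modnDmr addnA.
Qed.

Lemma leibnitz_bracket_lie (K : fieldType) (G : lmodType K) (n : nat)
    (br : G -> G -> G) (hbr : lie_bracket br) :
  lie_bracket (tensor_bracket (leibnitz_tensor K n) br).
Proof.
apply: tensor_bracket_lie => // [i j s|i j k m].
  by rewrite /leibnitz_tensor addnC.
by rewrite !triple_leibnitz_tensor -addnA addnC.
Qed.

Lemma cyclic_bracketE (K : fieldType) (G : lmodType K) (n : nat)
    (br : G -> G -> G) :
  cyclic_bracket br = tensor_bracket (@cyclic_tensor K n) br :> (_ -> _ -> _).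
Proof.
apply/funext => x; apply/funext => y; apply/ffunP=> i; rewrite !ffunE.
apply: eq_bigr => s _; rewrite big_mkcond; apply: eq_bigr => k _.
rewrite /cyclic_tensor /kronecker scaler_nat mulrb.
by rewrite (modn_small (ltn_ord i)).
Qed.

Lemma cyclic_bracket_lie (K : fieldType) (G : lmodType K) (n : nat)
    (br : G -> G -> G) (hbr : lie_bracket br) :
  lie_bracket (@cyclic_bracket K G n br).
Proof.
rewrite cyclic_bracketE; apply: tensor_bracket_lie => // [i j s|i j k m].
  by rewrite /cyclic_tensor addnC.
by rewrite !triple_cyclic_tensor -addnA addnC.
Qed.

Definition unit_tuple (K : fieldType) (G : lmodType K) (n : nat) (i : 'I_n)
    (a : G) : {ffun 'I_n -> G} :=
  [ffun j => if j == i then a else 0].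

Lemma unit_tuple_coordinate (K : fieldType) (G : lmodType K) (n : nat)
    (i : 'I_n) (a : G) :
  @coordinate_subspace K G n i (unit_tuple i a).
Proof. by move=> j /negPf ji; rewrite ffunE ji. Qed.

(** A tuple decomposes along the coordinate subspaces in exactly one way; this
    gives both that the sum is direct and the value of [component]. *)
Lemma coordinate_decomposition (K : fieldType) (G : lmodType K) (n : nat)
    (x : {ffun 'I_n -> G}) (z : {ffun 'I_n -> {ffun 'I_n -> G}}) :
  decomposes (@coordinate_subspace K G n) x z <->
  z = [ffun i => unit_tuple i (x i)].
Proof.
split=> [[Fz ->]|->]; last first.
  split=> [i j j_neq|]; first by rewrite !ffunE (negPf j_neq).
  apply/ffunP=> j; rewrite sum_ffunE (bigD1 j) //= !ffunE eqxx.
  by rewrite big1 ?addr0 // => i; rewrite !ffunE eq_sym => /negPf ->.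
apply/ffunP=> i; apply/ffunP=> j; rewrite !ffunE.
case: eqP => [->|/eqP j_neq]; last exact: Fz.
by rewrite sum_ffunE (bigD1 i) //= big1 ?addr0 // => k ki; apply: Fz; rewrite eq_sym.
Qed.

Lemma coordinate_component (K : fieldType) (G : lmodType K) (n : nat)
    (x : {ffun 'I_n -> G}) (i : 'I_n) :
  component (@coordinate_subspace K G n) x i = unit_tuple i (x i).
Proof.
rewrite /component.
rewrite (@xget_unique _ 0 _ [ffun i => unit_tuple i (x i)]) ?ffunE //.
  exact/coordinate_decomposition.
by move=> z /coordinate_decomposition.
Qed.

Lemma coordinate_direct (K : fieldType) (G : lmodType K) (n : nat) :
  direct_decomposition (@coordinate_subspace K G n).
Proof.
split=> [i|x].
  split=> [|a u v]; rewrite !inE; first by move=> j _; rewrite ffunE.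
  by move=> Fu Fv j ji; rewrite !ffunE Fu ?Fv // scaler0 addr0.
exists [ffun i => unit_tuple i (x i)].
by split=> [|z /coordinate_decomposition ->] //; apply/coordinate_decomposition.
Qed.

Lemma tensor_bracket_homogeneous (K : fieldType) (G : lmodType K) (n : nat)
    (W : tensor K 'I_n) (br : G -> G -> G) (hbr : lie_bracket br)
    (i j : 'I_n) (x y : {ffun 'I_n -> G}) (s : 'I_n) :
  coordinate_subspace i x -> coordinate_subspace j y ->
  tensor_bracket W br x y s = W i j s *: br (x i) (y j).
Proof.
move=> Fx Fy; rewrite ffunE (bigD1 i) //= (bigD1 j) //= !big1 ?addr0 //.
  move=> k ki; apply: big1 => l _.
  by rewrite Fx // (linear0 (lie_linearl hbr _)) scaler0.
by move=> l lj; rewrite Fy // (linear0 (lie_linearr hbr _)) scaler0.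
Qed.

Lemma cyclic_bracket_grading (K : fieldType) (G : lmodType K) (n : nat)
    (br : G -> G -> G) (hbr : lie_bracket br) :
  cyclic_grading (cyclic_bracket br) (@coordinate_subspace K G n).
Proof.
split=> [|i j k ijk x y Fx Fy s sk]; first exact: coordinate_direct.
rewrite cyclic_bracketE (tensor_bracket_homogeneous _ hbr (i := i) (j := j)) //.
by rewrite /cyclic_tensor /kronecker ijk val_eqE eq_sym (negPf sk) scale0r.
Qed.

(** The terms x_s and y_l with s + l = i lie in coordinate subspaces, and since
    i < n their cyclic bracket is the single entry [br (x s) (y l)] in place
    i = s + l. Collecting the entries in place m leaves the pairs with
    s + l = m, which is the Leibnitz tensor. *)
Lemma deformation0_cyclic_bracketE (K : fieldType) (G : lmodType K) (n : nat)
    (br : G -> G -> G) (hbr : lie_bracket br) :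
  deformation (cyclic_bracket br) (@coordinate_subspace K G n) 0 =
  tensor_bracket (leibnitz_tensor K n) br :> (_ -> _ -> _).
Proof.
apply/funext => x; apply/funext => y; apply/ffunP=> m.
rewrite /deformation sum_ffunE.
transitivity (\sum_(i < n) \sum_(s < n) \sum_(l < n)
   (kronecker K m i * kronecker K (s + l) i) *: br (x s) (y l)).
  apply: eq_bigr => i _; rewrite scale0r addr0 sum_ffunE.
  apply: eq_bigr => s _; rewrite sum_ffunE big_mkcond; apply: eq_bigr => l _.
  rewrite /kronecker; case: eqP => [sl|_]; last by rewrite mulr0 scale0r.
  rewrite !coordinate_component cyclic_bracketE.
  rewrite (tensor_bracket_homogeneous _ hbr (i := s) (j := l));
    try exact: unit_tuple_coordinate.
  by rewrite !ffunE !eqxx mulr1 /cyclic_tensor /kronecker sl modn_small // eq_sym.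
rewrite ffunE exchange_big; apply: eq_bigr => s _.
rewrite exchange_big; apply: eq_bigr => l _; rewrite -scaler_suml.
under eq_bigr => i _ do rewrite mulrC.
by rewrite (@sum_mul_kronecker K n m (fun i => kronecker K (s + l) i)) ltn_ord.
Qed.

Theorem mainTheorem2 (R : realType) (c : classical)
    (G : lmodType (classical_field R c)) (br : G -> G -> G)
    (hbr : lie_bracket br) (n : nat) (hn : (1 <= n)%N) :
  let K := classical_field R c in
  let F : 'I_n -> set {ffun 'I_n -> G} := @coordinate_subspace K G n in
  let brE0 : {ffun 'I_n -> G} -> {ffun 'I_n -> G} -> {ffun 'I_n -> G} :=
    cyclic_bracket br in
  let brL : {ffun 'I_n -> G} -> {ffun 'I_n -> G} -> {ffun 'I_n -> G} :=
    deformation brE0 F 0 in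
  let W : tensor K 'I_n := leibnitz_tensor K n in
  lie_bracket brE0 /\
  cyclic_grading brE0 F /\
  lie_bracket brL /\
  (forall (x y : {ffun 'I_n -> G}) (s : 'I_n),
     brL x y s = \sum_(i < n) \sum_(j < n) W i j s *: br (x i) (y j)) /\
  (forall (i j : 'I_n) (hij : (i + j < n)%N) (x y : {ffun 'I_n -> G}),
     F i x -> F j y -> F (Ordinal hij) (brL x y)) /\
  (forall (i j : 'I_n), (n <= i + j)%N -> forall x y : {ffun 'I_n -> G},
     F i x -> F j y -> brL x y = 0) /\
  (forall i j k : positive_index n,
     solvable_part W i j k = solvable_leibnitz_tensor K n i j k).
Proof.
move=> K F brE0 brL W.
have brLE : brL = tensor_bracket W br.
  exact: (deformation0_cyclic_bracketE n hbr).
split; first exact: (cyclic_bracket_lie n hbr).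
split; first exact: (cyclic_bracket_grading n hbr).
rewrite brLE; split; first exact: (leibnitz_bracket_lie n hbr).
split=> [x y s|]; first by rewrite ffunE.
split=> [i j hij x y Fx Fy s s_neq|].
  rewrite (tensor_bracket_homogeneous W hbr (i := i) (j := j)) //.
  by rewrite -val_eqE eq_sym in s_neq; rewrite /W /leibnitz_tensor /kronecker
    (negPf s_neq) scale0r.
split=> // i j n_le x y Fx Fy; apply/ffunP=> s.
rewrite (tensor_bracket_homogeneous W hbr (i := i) (j := j)) // ffunE.
rewrite /W /leibnitz_tensor /kronecker gtn_eqF ?scale0r //.
exact: leq_trans (ltn_ord s) n_le.
Qed.
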